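(* Let $\boldsymbol\psi$ be a parabolic filtration of $\Phi$ of depth at most $r$ with Levi factor $\boldsymbol\phi$, and let $\boldsymbol\chi\colon\mathfrak p_{\boldsymbol\psi}\to\mathbb C$ be a character, corresponding to $\boldsymbol\lambda=(\lambda_0,\dots,\lambda_{r-1})\in\mathfrak Z_{\boldsymbol\phi}^\vee$. Then the restriction $\boldsymbol\chi|_{\mathfrak l_{\boldsymbol\phi}}$ is nonsingular if and only if $\boldsymbol\lambda$ lies in the stratum $\mathfrak t^{\vee,r}_{\boldsymbol\phi^\vee}$ associated with the dual Levi filtration, i.e. if and only if $$\langle\lambda_i,\alpha^\vee\rangle\neq0\qquad\text{for all } i\in\{0,\dots,r-1\}\text{ and all }\alpha\in\phi_{i+1}\setminus\phi_i .$$
   Context: $\mathfrak g$ is a complex reductive Lie algebra with Cartan subalgebra $\mathfrak t$, roots $\Phi$, root spaces $\mathfrak g_\alpha$, coroots $\alpha^\vee\in\mathfrak t$. $r\ge1$, $\mathbb C_r=\mathbb C[[z]]/z^r\mathbb C[[z]]$, $\varepsilon$ = class of $z$, $\mathfrak g_r=\mathfrak g\otimes\mathbb C_r=\bigoplus_{i=0}^{r-1}\mathfrak g\varepsilon^i$. A subset $\psi\subseteq\Phi$ is parabolic if it is closed under sums within $\Phi$ and $\psi\cup(-\psi)=\Phi$. A parabolic filtration of depth at most $r$ is a sequence $\boldsymbol\psi=(\psi_i)_{i\ge0}$ of parabolic subsets with $\psi_i\subseteq\psi_{i+1}$ and $\psi_i=\Phi$ for $i\ge r$; Levi factor $\boldsymbol\phi$: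 $\phi_i=\psi_i\cap(-\psi_i)$ (so $\phi_r=\Phi$). Let $\mathfrak l_{\phi_i}=\mathfrak t\oplus\bigoplus_{\phi_i}\mathfrak g_\alpha$, $\mathfrak u^\pm_{\psi_i}=\bigoplus_{\alpha\in\psi_i\setminus\phi_i}\mathfrak g_{\pm\alpha}$, $\mathfrak l_{\boldsymbol\phi}=\bigoplus_{i<r}\mathfrak l_{\phi_i}\varepsilon^i$, $\mathfrak u^\pm_{\boldsymbol\psi}=\bigoplus_{i<r}\mathfrak u^\pm_{\psi_i}\varepsilon^i$, $\mathfrak p_{\boldsymbol\psi}=\mathfrak l_{\boldsymbol\phi}\oplus\mathfrak u^+_{\boldsymbol\psi}$ (the finite singularity algebra), so that $\mathfrak g_r=\mathfrak u^-_{\boldsymbol\psi}\oplus\mathfrak l_{\boldsymbol\phi}\oplus\mathfrak u^+_{\boldsymbol\psi}$ as vector spaces; $\pi_{\boldsymbol\phi}\colon\mathfrak g_r\to\mathfrak l_{\boldsymbol\phi}$ is the projection parallel to $\mathfrak u^-_{\boldsymbol\psi}\oplus\mathfrak u^+_{\boldsymbol\psi}$. Let $\mathfrak Z_{\phi_i}=\bigcap_{\alpha\in\phi_i}\ker\alpha\subseteq\mathfrak t$; $\mathfrak Z_{\phi_i}^\vee$ is identified with the covectors in $\mathfrak t^\vee$ vanishing on $\alpha^\vee$ for all $\alpha\in\phi_i$. Characters of $\mathfrak p_{\boldsymbol\psi}$ correspond bijectively to $\boldsymbol\lambda\in\mathfrak Z_{\boldsymbol\phi}^\vee=\bigoplus_{i<r}\mathfrak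 Z_{\phi_i}^\vee$ via $\boldsymbol\chi(X\varepsilon^i)=\lambda_i(X)$ for $X\in\mathfrak t$ and $\boldsymbol\chi=0$ on root vectors. The dual stratum is $\mathfrak t^{\vee,r}_{\boldsymbol\phi^\vee}=\{(\lambda_i)_i\in(\mathfrak t^\vee)^r:\lambda_i(\alpha^\vee)=0\ \forall\alpha\in\phi_i,\ \lambda_i(\alpha^\vee)\neq0\ \forall\alpha\in\phi_{i+1}\setminus\phi_i,\ 0\le i\le r-1\}$. A character $\boldsymbol\chi\colon\mathfrak l_{\boldsymbol\phi}\to\mathbb C$ is nonsingular if it extends by zero to a character of $\mathfrak p_{\boldsymbol\psi}$ and the pairing $B\colon\mathfrak u^+_{\boldsymbol\psi}\otimes\mathfrak u^-_{\boldsymbol\psi}\to\mathbb C$, $\boldsymbol Y\otimes\boldsymbol Y'\mapsto\langle\boldsymbol\chi,\pi_{\boldsymbol\phi}([\boldsymbol Y,\boldsymbol Y'])\rangle$, is nondegenerate. *)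

(* Defs.v *)
From HB Require Import structures.
From mathcomp Require Import all_boot all_order all_algebra.
From mathcomp Require Import finmap boolp classical_sets reals complex.

Set Implicit Arguments.
Unset Strict Implicit.
Unset Printing Implicit Defensive.
Import GRing.Theory.
Local Open Scope ring_scope.

HB.mixin Record isLie (K : fieldType) g of Vector K g := {
  lie : g -> g -> g;
  lie_linear_l : forall y, linear (lie ^~ y);
  lie_linear_r : forall x, linear (lie x);
  liexx : forall x, lie x x = 0;
  lie_jacobi : forall x y z,
    lie x (lie y z) + lie y (lie z x) + lie z (lie x y) = 0
}.

#[short(type="lieType")]
HB.structure Definition Lie (K : fieldType) := {g of isLie K g & Vector K g}.

Section LieTheory.
Variables (K : fieldType) (g : lieType K).

HB.instance Definition _ (x : g) :=
  GRing.isLinear.Build K g g _ (lie x) (lie_linear_r x).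

Lemma lieC (x y : g) : lie x y = - lie y x.
Proof.
apply/eqP; rewrite -addr_eq0; apply/eqP.
have := liexx (x + y); rewrite (linearD (lie (x + y))) /=.
have lD z : lie (x + y) z = lie x z + lie y z.
  by have := lie_linear_l z 1 x y; rewrite !scale1r.
by rewrite !lD !liexx add0r addr0 addrC.
Qed.

Definition lie_ideal (I : {vspace g}) : Prop :=
  forall x y, y \in I -> lie x y \in I.

(* Complete reducibility of the adjoint representation. *)
Definition reductive : Prop :=
  forall I, lie_ideal I ->
  exists J, [/\ lie_ideal J, (I + J = fullv)%VS & (I :&: J = 0)%VS].

Definition ad_diagonalizable (h : g) : Prop :=
  exists2 X : seq g, basis_of fullv X &
    forall x, x \in X -> exists a : K, lie h x = a *: x.

(* Cartan subalgebras of reductive Lie algebras: self-centralizing and toral. *)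
Definition cartan_subalgebra (t : {vspace g}) : Prop :=
  [/\ {in t &, forall h k, lie h k = 0},
      forall x, {in t, forall h, lie h x = 0} -> x \in t &
      {in t, forall h, ad_diagonalizable h}].

Definition lie_prodv (U V : {vspace g}) : {vspace g} :=
  <<[seq lie x y | x <- vbasis U, y <- vbasis V]>>%VS.

(* [vsproj U] is only applied to brackets that lie in [U], since [U] is meant
   to be a Lie subalgebra. *)
Definition lie_character (U : {vspace g}) (chi : 'Hom(subvs_of U, K^o)) : Prop :=
  {in U &, forall x y, chi (vsproj U (lie x y)) = 0}.

End LieTheory.

Section Roots.
Variables (K : fieldType) (g : lieType K) (t : {vspace g}).
Local Notation dual := 'Hom(subvs_of t, K^o).
Implicit Types (a : dual) (x : g) (h : subvs_of t).

Definition weight_defect a x h : g := lie (vsval h) x - (a h : K) *: x.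

(* The weight space of [a]: the kernel of x |-> (h |-> [h, x] - a(h) x). *)
Definition weightv a : {vspace g} :=
  lker (linfun (fun x => linfun (weight_defect a x) : 'Hom(subvs_of t, g))).

Fact weight_defect_linear a x : linear (weight_defect a x).
Proof.
move=> c h k; rewrite /weight_defect !linearP /= (lie_linear_l x) scalerBr.
by rewrite scalerDl scalerA opprD addrACA.
Qed.

Lemma memv_weightP a x :
  reflect (forall h, lie (vsval h) x = (a h : K) *: x) (x \in weightv a).
Proof.
pose lin y := GRing.isLinear.Build _ _ _ _ _ (weight_defect_linear a y).
have dE y h : linfun (weight_defect a y) h = weight_defect a y h.
  pose F : {linear _ -> _} := HB.pack (weight_defect a y) (lin y).
  exact: (lfunE F).
have lF : linear (fun y => linfun (weight_defect a y) : 'Hom(subvs_of t, g)).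
  move=> c y z; apply/lfunP => h; rewrite add_lfunE scale_lfunE !dE.
  rewrite /weight_defect linearP scalerBr scalerDr !scalerA opprD addrACA.
  by rewrite [c * _]mulrC.
pose F : {linear _ -> _} := HB.pack
  (fun y => linfun (weight_defect a y) : 'Hom(subvs_of t, g))
  (GRing.isLinear.Build _ _ _ _ _ lF).
rewrite memv_ker (lfunE F) /=; apply: (iffP eqP) => [F0 h | xa].
  by apply/eqP; rewrite -subr_eq0 -[_ - _]/(weight_defect a x h) -dE F0 lfunE.
by apply/lfunP => h; rewrite dE lfunE /= /weight_defect xa subrr.
Qed.

Definition roots : {pred dual} := [pred a | (a != 0) && (weightv a != 0%VS)].

(* The element of [g_a, g_(-a)] on which [a] takes the value 2. *)
Definition coroot a : subvs_of t :=
  xget 0 [set h | vsval h \in lie_prodv (weightv a) (weightv (- a))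
                  /\ a h = 2 :> K]%classic.

End Roots.

Arguments roots {K g} t.

Section TruncatedCurrents.
Variables (K : fieldType) (r : nat) (g : lieType K).

(* g (x) K[[z]]/(z^r): the element X stands for \sum_(i < r) X i * eps^i. *)
Definition currents := {ffun 'I_r -> g}.
Local Notation gr := currents.

HB.instance Definition _ := Vector.copy gr {ffun 'I_r -> g}.

Definition lie_currents (X Y : gr) : gr :=
  [ffun k : 'I_r => \sum_(i < r) \sum_(j < r | (i + j == k)%N) lie (X i) (Y j)].

Fact lie_currents_linear_l Y : linear (lie_currents^~ Y).
Proof.
move=> c X X'; apply/ffunP => k; rewrite !ffunE scaler_sumr -big_split /=.
apply: eq_bigr => i _; rewrite scaler_sumr -big_split /=.
by apply: eq_bigr => j _; rewrite !ffunE (lie_linear_l (Y j)).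
Qed.

Fact lie_currents_linear_r X : linear (lie_currents X).
Proof.
move=> c Y Y'; apply/ffunP => k; rewrite !ffunE scaler_sumr -big_split /=.
apply: eq_bigr => i _; rewrite scaler_sumr -big_split /=.
by apply: eq_bigr => j _; rewrite !ffunE linearP.
Qed.

Fact lie_currentsxx X : lie_currents X X = 0.
Proof.
apply/ffunP => k; rewrite !ffunE pair_big_dep /=.
rewrite (bigID (fun p : 'I_r * 'I_r => (p.1 < p.2)%N)) /=.
rewrite [X in _ + X](bigID (fun p : 'I_r * 'I_r => (p.2 < p.1)%N)) /=.
rewrite [X in _ + (_ + X)]big1 ?addr0; last first.
  move=> [i j] /= /andP[/andP[_]]; rewrite -!leqNgt => ji ij.
  have -> : i = j by apply: ord_inj; apply: anti_leq; rewrite ij ji.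
  exact: liexx.
rewrite [X in _ + X](reindex_inj (h := fun p : 'I_r * 'I_r => (p.2, p.1))) /=;
  last by move=> [? ?] [? ?] /= [-> ->].
rewrite [X in _ + X](eq_bigl (fun p : 'I_r * 'I_r =>
    (p.1 + p.2 == k)%N && (p.1 < p.2)%N)); last first.
  move=> [i j] /=; rewrite [(j + i)%N]addnC.
  by case: (ltngtP i j); rewrite ?andbF ?andbT.
by rewrite -big_split big1 //= => -[i j] _ /=; rewrite lieC addNr.
Qed.

Fact lie_currents2E X Y Z (k : 'I_r) : lie_currents X (lie_currents Y Z) k =
  \sum_(i < r) \sum_(j < r) \sum_(l < r | (i + (j + l) == k)%N)
    lie (X i) (lie (Y j) (Z l)).
Proof.
rewrite ffunE; apply: eq_bigr => i _.
under eq_bigr => m _ do rewrite ffunE linear_sum.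
rewrite exchange_big /=; apply: eq_bigr => j _.
under eq_bigr => m _ do rewrite linear_sum big_mkcond.
rewrite exchange_big /= [RHS]big_mkcond; apply: eq_bigr => l _.
rewrite -big_mkcondr /=; case: ifPn => [/eqP ijl | ijl]; last first.
  rewrite big1 // => m /andP[/eqP im /eqP jl].
  by move: ijl; rewrite jl im eqxx.
have jlr : (j + l < r)%N.
  by apply: leq_ltn_trans (ltn_ord k); rewrite -ijl leq_addl.
rewrite (big_pred1 (Ordinal jlr)) // => m /=.
rewrite -val_eqE /= [m == _ :> nat]eq_sym andbC.
by case: eqP => //= <-; rewrite ijl eqxx.
Qed.

Fact lie_currents_jacobi X Y Z :
  lie_currents X (lie_currents Y Z) + lie_currents Y (lie_currents Z X)
    + lie_currents Z (lie_currents X Y) = 0.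
Proof.
apply/ffunP => k; have E (U V : gr) : (U + V) k = U k + V k by rewrite ffunE.
rewrite 2!E !lie_currents2E ffunE.
set T := \sum_i _; set T1 := \sum_i _; set T2 := \sum_i _.
have -> : T1 = \sum_(i < r) \sum_(j < r) \sum_(l < r | (i + (j + l) == k)%N)
    lie (Y j) (lie (Z l) (X i)).
  rewrite /T1; under eq_bigr => j _ do under eq_bigr => l _ do rewrite big_mkcond.
  under eq_bigr => j _ do rewrite exchange_big.
  rewrite exchange_big /=; apply: eq_bigr => i _; apply: eq_bigr => j _.
  rewrite [RHS]big_mkcond; apply: eq_bigr => l _.
  by rewrite addnA [(j + l + i)%N]addnC.
have -> : T2 = \sum_(i < r) \sum_(j < r) \sum_(l < r | (i + (j + l) == k)%N)
    lie (Z l) (lie (X i) (Y j)).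
  rewrite /T2; under eq_bigr => l _ do under eq_bigr => i _ do rewrite big_mkcond.
  rewrite exchange_big /=; apply: eq_bigr => i _.
  rewrite exchange_big /=; apply: eq_bigr => j _.
  rewrite [RHS]big_mkcond; apply: eq_bigr => l _.
  by rewrite addnC addnA.
rewrite /T -!big_split big1 // => i _; rewrite -!big_split big1 // => j _.
by rewrite -!big_split big1 // => l _; apply: lie_jacobi.
Qed.

HB.instance Definition _ := isLie.Build K gr lie_currents_linear_l
  lie_currents_linear_r lie_currentsxx lie_currents_jacobi.

(* [monomial i x] is x * eps^i. *)
Definition monomial (i : 'I_r) (x : g) : gr :=
  [ffun j => if j == i then x else 0].

Fact monomial_linear i : linear (monomial i).
Proof.
move=> c x y; apply/ffunP => j; rewrite !ffunE.
by case: eqP => // _; rewrite scaler0 addr0.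
Qed.

HB.instance Definition _ i :=
  GRing.isLinear.Build K g gr _ (monomial i) (monomial_linear i).

(* \bigoplus_(i < r) U_i * eps^i *)
Definition graded_currents (U : nat -> {vspace g}) : {vspace gr} :=
  (\sum_(i < r) linfun (monomial i) @: U i)%VS.

Lemma mem_graded_currents (U : nat -> {vspace g}) (X : gr) :
  reflect (forall i, X i \in U i) (X \in graded_currents U).
Proof.
have XE : X = \sum_(i < r) monomial i (X i).
  apply/ffunP => j; rewrite sum_ffunE (bigD1 j) //= ffunE eqxx big1 ?addr0 //.
  by move=> i /negPf ij; rewrite ffunE eq_sym ij.
apply: (iffP memv_sumP) => [[Y YU ->] i | XU].
  rewrite sum_ffunE memv_suml // => j _.
  have /memv_imgP[y yU ->] := YU j isT; rewrite lfunE ffunE.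
  by case: eqP => [-> // | _]; apply: mem0v.
exists (fun i => monomial i (X i)) => // i _.
by rewrite -[monomial i _]lfunE memv_img.
Qed.

End TruncatedCurrents.

Section ParabolicFiltrations.
Variables (K : fieldType) (g : lieType K) (t : {vspace g}).
Local Notation dual := 'Hom(subvs_of t, K^o).
Implicit Types psi phi : nat -> {fset dual}.

(* Subsets of the (finite) set of roots are encoded as finite sets of
   covectors. *)
Definition parabolic (P : {fset dual}) : Prop :=
  [/\ {subset P <= roots t},
      {in P &, forall a b, a + b \in roots t -> a + b \in P} &
      forall a, (a \in P) || (- a \in P) = (a \in roots t)].

Definition parabolic_filtration (r : nat) psi : Prop :=
  [/\ forall i, parabolic (psi i),
      forall i, {subset psi i <= psi i.+1} &
      forall i, (r <= i)%N -> psi i =i roots t].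

Definition levi psi : nat -> {fset dual} :=
  fun i => [fset a in psi i | - a \in psi i]%fset.

Definition levi_subalgebra (phi0 : {fset dual}) : {vspace g} :=
  (t + \sum_(a <- phi0) weightv a)%VS.

Variable r : nat.

Definition levi_currents phi : {vspace currents r g} :=
  graded_currents r (fun i => levi_subalgebra (phi i)).

Definition nil_plus psi : {vspace currents r g} :=
  graded_currents r
    (fun i => \sum_(a <- (psi i `\` levi psi i)%fset) weightv a)%VS.

Definition nil_minus psi : {vspace currents r g} :=
  graded_currents r
    (fun i => \sum_(a <- (psi i `\` levi psi i)%fset) weightv (- a))%VS.

Definition singularity_algebra psi : {vspace currents r g} :=
  (levi_currents (levi psi) + nil_plus psi)%VS.

Definition levi_projection psi : 'End(currents r g) :=
  daddv_pi (levi_currents (levi psi)) (nil_minus psi + nil_plus psi).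

(* The sum over i < r of the covectors of t that vanish on the coroots of
   phi_i, i.e., of the duals of the centres of the Levi subalgebras. *)
Definition central_covectors phi (lam : 'I_r -> dual) : Prop :=
  forall (i : 'I_r) a, a \in phi i -> lam i (coroot a) = 0.

Definition dual_stratum phi (lam : 'I_r -> dual) : Prop :=
  forall i : 'I_r,
    (forall a, a \in phi i -> lam i (coroot a) = 0) /\
    (forall a, a \in (phi i.+1 `\` phi i)%fset -> lam i (coroot a) != 0).

Definition character_of_covectors psi
    (chi : 'Hom(subvs_of (singularity_algebra psi), K^o))
    (lam : 'I_r -> dual) : Prop :=
  (forall i (h : subvs_of t),
     chi (vsproj _ (monomial i (vsval h))) = lam i h) /\
  (forall (i : 'I_r) a x, a \in psi i -> x \in weightv a ->
     chi (vsproj _ (monomial i x)) = 0).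

Definition restrict_levi psi
    (chi : 'Hom(subvs_of (singularity_algebra psi), K^o)) :
    'Hom(subvs_of (levi_currents (levi psi)), K^o) :=
  linfun (fun X => chi (vsproj (singularity_algebra psi) (vsval X))).

Definition extends_by_zero psi
    (chi : 'Hom(subvs_of (levi_currents (levi psi)), K^o))
    (chi' : 'Hom(subvs_of (singularity_algebra psi), K^o)) : Prop :=
  {in levi_currents (levi psi), forall X, chi' (vsproj _ X) = chi (vsproj _ X)}
  /\ {in nil_plus psi, forall Y, chi' (vsproj _ Y) = 0}.

Definition levi_pairing psi
    (chi : 'Hom(subvs_of (levi_currents (levi psi)), K^o))
    (Y Y' : currents r g) : K :=
  chi (vsproj _ (levi_projection psi (lie Y Y'))).

Definition nondegenerate_on (U V : {vspace currents r g})
    (B : currents r g -> currents r g -> K) : Prop :=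
  (forall Y, Y \in U -> {in V, forall Y', B Y Y' = 0} -> Y = 0) /\
  (forall Y', Y' \in V -> {in U, forall Y, B Y Y' = 0} -> Y' = 0).

Definition nonsingular psi
    (chi : 'Hom(subvs_of (levi_currents (levi psi)), K^o)) : Prop :=
  [/\ lie_character chi,
      exists2 chi' : 'Hom(subvs_of (singularity_algebra psi), K^o),
        lie_character chi' & extends_by_zero chi chi' &
      nondegenerate_on (nil_plus psi) (nil_minus psi) (levi_pairing chi)].

End ParabolicFiltrations.

(* Main.v *)
Require Import Defs.
From HB Require Import structures.
From mathcomp Require Import all_boot all_order all_algebra.
From mathcomp Require Import finmap boolp classical_sets reals complex.

Set Implicit Arguments.
Unset Strict Implicit.
Unset Printing Implicit Defensive.
Import Order.TTheory GRing.Theory Num.Theory passmx.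
Local Open Scope ring_scope.

(** The pairing splits along roots.  If [x] lies in [g_a] and [y] in [g_(-b)],
    the Levi component of [[x eps^i, y eps^j]] is killed by the character
    unless [a = b], and then the pairing is [lam_(i+j) [x, y]], where [[x, y]]
    is a multiple of the coroot of [a].  The levels [i] at which [a] is a root
    of the nilradical form an initial interval [0..e] ([nilradical_interval]),
    and [a] belongs to the Levi factor at every level above [e], so that
    [lam_k] vanishes on the coroot of [a] for [k > e].  On the [a]-block the
    pairing is therefore a Hankel matrix with zeros below its antidiagonal,
    whose antidiagonal entries all come from [lam_e]; it is nondegenerate
    exactly when [lam_e] does not vanish on the coroot of [a].  Since [e] is the
    level at which [a] enters the Levi factor, this is the stratum condition
    ([central_pairing_nondegenerate] and [nondegenerate_of_stratum] in one
    direction, [stratum_of_nondegenerate] in the other).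

    This needs two facts about a reductive Lie algebra with Cartan subalgebra
    [t]: brackets of [g_a] with [g_(-a)] are multiples of the coroot
    ([lie_root_coroot]), and every nonzero [x] in [g_a] has a nonzero bracket
    with some [y] in [g_(-a)] ([coroot_partner]).  Reductivity is complete
    reducibility of the adjoint representation;
    it enters through ideals complementary to well-chosen ones.

    - The trace of [ad [x, y]] on a string of weight spaces [c + Z a] vanishes,
      hence every weight [c] takes on [[g_a, g_(-a)]] values proportional to
      those of [a], with a rational ratio ([weight_coroot_line]).  An element of
      [[g_a, g_(-a)]] killed by [a] is therefore central, and a central element
      spanned by brackets is [0] because the centre has a complementary ideal.
      So [a] is injective on [[g_a, g_(-a)]], which is at most a line.

    - If [x] in [g_a] commutes with [g_(-a)], then [x] lies in the kernel of the
      Killing form.  The elements of this kernel without component in [t] form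
      an ideal [D].  An ideal complementary to [D] commutes with [D], so
      [[h, x]] is the bracket of [x] with the [D]-part of [h], for [h] in [t]; this
      bracket has no component in [g_a], whence [[h, x] = 0] and [x = 0]. *)

(** * Linear algebra *)

Section LinearAlgebra.
Variables (K : fieldType) (V : vectType K).

(** A subspace of maximal dimension among those contained in [P] is all of [P];
    this turns ideals given by a condition into members of [{vspace V}]. *)
Lemma vspace_of_closed (P : V -> Prop) : P 0 ->
    (forall c u v, P u -> P v -> P (c *: u + v)) ->
  exists U : {vspace V}, forall v, v \in U <-> P v.
Proof.
move=> P0 Plin.
pose contained n :=
  `[< exists2 U : {vspace V}, \dim U = n & {in U, forall v, P v} >].
have ex0 : exists n, contained n.
  by exists 0%N; apply/asboolP; exists 0%VS; rewrite ?dimv0 // => v;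
    rewrite memv0 => /eqP->.
have bound n : contained n -> (n <= \dim {:V})%N.
  by move=> /asboolP[U <- _]; apply/dimvS/subvf.
case: (ex_maxnP ex0 bound) => n /asboolP[U Un UP] max_n.
exists U => v; split=> [/UP // | Pv].
have : contained (\dim (U + <[v]>)).
  apply/asboolP;
    exists (U + <[v]>)%VS => // _ /memv_addP[u uU [_ /vlineP[c ->] ->]].
  by rewrite addrC; apply: Plin (UP _ uU).
move=> /max_n; rewrite -Un => dimU.
have /eqP -> : (U == U + <[v]>)%VS by rewrite eqEdim addvSl.
by rewrite -{1}[v]add0r memv_add ?mem0v ?memv_line.
Qed.

(** Commuting diagonalizable matrices are codiagonalizable; here this is
    carried over to endomorphisms. *)
Lemma common_eigenbasis (fs : seq 'End(V)) :
    {in fs &, forall f h, (f \o h = h \o f)%VF} ->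
    {in fs, forall f : 'End(V), exists2 X : seq V, basis_of fullv X &
      forall x, x \in X -> exists a : K, f x = a *: x} ->
  exists2 X : (\dim {:V}).-tuple V, basis_of fullv X &
    {in fs, forall (f : 'End(V)) (i : 'I_(\dim {:V})),
      exists a : K, f X`_i = a *: X`_i}.
Proof.
move=> fsC fsD; pose e := vbasis {:V}; have eB : basis_of fullv e := vbasisP _.
pose M := mxof e e.
have MD f : f \in fs -> diagonalizable (M f).
  move=> /fsD[X XB Xf].
  have sX : size X == \dim {:V} by rewrite (size_basis (X := in_tuple X) XB).
  pose P := \matrix_(i < \dim {:V}) rVof e X`_i.
  have /choice[a fX] (i : 'I_(\dim {:V})) : exists c : K, f X`_i = c *: X`_i.
    by apply/Xf/mem_nth; rewrite (eqP sX).
  have Pu : P \in unitmx.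
    rewrite -row_free_unit; apply/row_freeP.
    exists (\matrix_(i, j) coord (Tuple sX) j e`_i).
    apply/matrixP=> i j; rewrite !mxE.
    have := coord_free i j (basis_free (X := Tuple sX) XB).
    rewrite [X in coord _ _ X](coord_basis eB (memvf _)) linear_sum => <-.
    by apply: eq_bigr => k _; rewrite linearZ !mxE.
  exists P => //; apply/diagonalizable_forPex; exists (\row_i a i).
  apply/simmxP => //; apply/row_matrixP => i.
  rewrite !row_mul rowK row_diag_mx -scalemxAl -rowE rowK mxE -rVof_app //.
  by rewrite fX linearZ.
have [P Pu /allP PD] : codiagonalizable [seq M f | f <- fs].
  apply/codiagonalizableP;
    split=> [_ _ /mapP[f ffs ->] /mapP[h hfs ->]|_ /mapP[f ffs ->]].
    by rewrite /comm_mx -!mxof_comp // fsC.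
  exact: MD.
pose X := [tuple vecof e (row i P) | i < \dim {:V}].
have XE (i : 'I_ _) : X`_i = vecof e (row i P).
  by rewrite -tnth_nth tnth_mktuple.
exists X; last first.
  move=> f ffs i; have := PD _ (map_f _ ffs).
  move=> /= /diagonalizable_forPex[D /(simmxP Pu) PM]; exists (D 0 i).
  rewrite XE (hom_vecof e eB) -row_mul PM row_mul row_diag_mx -scalemxAl -rowE.
  by rewrite linearZ.
rewrite basisEdim size_tuple leqnn andbT; apply/subvP => v _.
rewrite -[v](rVofK eB) -[rVof _ _](mulmxKV Pu).
set c := _ *m invmx P; rewrite mulmx_sum_row linear_sum memv_suml // => i _.
by rewrite linearZ memvZ //= -XE memv_span // mem_nth ?size_tuple.
Qed.

End LinearAlgebra.

(** * Brackets in Lie algebras *)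

Section LieBrackets.
Variables (K : fieldType) (g : lieType K).
Implicit Types x y z : g.

Lemma lieDl y x x' : lie (x + x') y = lie x y + lie x' y.
Proof. by have := lie_linear_l y 1 x x'; rewrite !scale1r. Qed.

Lemma lie0l y : lie 0 y = 0.
Proof. by apply: (addrI (lie 0 y)); rewrite -lieDl !addr0. Qed.

Lemma lieZl y c x : lie (c *: x) y = c *: lie x y.
Proof. by have := lie_linear_l y c x 0; rewrite lie0l !addr0. Qed.

Lemma lie_suml y (I : Type) (s : seq I) (P : pred I) (F : I -> g) :
  lie (\sum_(i <- s | P i) F i) y = \sum_(i <- s | P i) lie (F i) y.
Proof. by apply: (big_morph (lie^~ y)) => [u v|]; rewrite ?lieDl ?lie0l. Qed.

Lemma lie_derivation x y z :
  lie x (lie y z) = lie (lie x y) z + lie y (lie x z).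
Proof.
have := lie_jacobi x y z;
  rewrite [lie z (lie x y)]lieC [lie z x]lieC linearN /=.
by move=> /subr0_eq <-; rewrite addrNK.
Qed.

Lemma lie_adjoint_commutator x y z :
  lie (lie x y) z = lie x (lie y z) - lie y (lie x z).
Proof. by rewrite lie_derivation addrK. Qed.

Lemma mem_lie_prodv (U V : {vspace g}) x y :
  x \in U -> y \in V -> lie x y \in lie_prodv U V.
Proof.
move=> xU yV; rewrite (coord_vbasis xU) (coord_vbasis yV) lie_suml.
apply: memv_suml => i _; rewrite linear_sum; apply: memv_suml => j _.
rewrite linearZ /= lieZl !memvZ // memv_span //.
by apply: allpairs_f; apply: mem_nth; rewrite size_tuple.
Qed.

Lemma lie_prodv_ind (U V : {vspace g}) (P : g -> Prop) :
    P 0 -> (forall c u v, P u -> P v -> P (c *: u + v)) ->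
    (forall x y, x \in U -> y \in V -> P (lie x y)) ->
  {in lie_prodv U V, forall z, P z}.
Proof.
move=> P0 Plin PUV; have [W WP] := vspace_of_closed P0 Plin.
suff /subvP sW : (lie_prodv U V <= W)%VS by move=> z /sW /WP.
apply/span_subvP => _ /allpairsP[[x y] /= [/vbasis_mem xU /vbasis_mem yV ->]].
exact/WP/PUV.
Qed.

End LieBrackets.

(** If [J] is an ideal complementary to the centre, all brackets lie in [J],
    since the central parts of their arguments do not contribute. *)
Lemma reductive_central_bracket (K : fieldType) (g : lieType K)
    (U V : {vspace g}) v :
  reductive g -> v \in lie_prodv U V -> (forall y, lie v y = 0) -> v = 0.
Proof.
move=> g_red vUV v0.
have [|c u u' u0 u'0 y|Z ZP] :=
    @vspace_of_closed _ g (fun v => forall y, lie v y = 0).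
- by move=> y; rewrite lie0l.
- by rewrite lieDl lieZl u0 u'0 scaler0 addr0.
have [|J [J_ideal ZJ ZJ0]] := g_red Z.
  by move=> x y /ZP y0; rewrite lieC y0 oppr0 mem0v.
suff vJ : v \in J by apply/eqP; rewrite -memv0 -ZJ0 memv_cap vJ andbT; apply/ZP.
move: v vUV {v0}; apply: lie_prodv_ind => [|c u u' uJ u'J|x y _ _];
  first exact: mem0v.
  by rewrite memvD ?memvZ.
have /memv_addP[z /ZP z0 [j jJ ->]] : y \in (Z + J)%VS by rewrite ZJ memvf.
by rewrite linearD /= [lie x z]lieC z0 oppr0 add0r J_ideal.
Qed.

(** * Bases of weight vectors *)

Section WeightBasis.
Variables (K : fieldType) (g : lieType K) (t : {vspace g}).
Local Notation dual := 'Hom(subvs_of t, K^o).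

Definition weight_basis n (X : n.-tuple g) (w : 'I_n -> dual) : Prop :=
  basis_of fullv X /\
  forall (i : 'I_n) h, lie (vsval h) X`_i = (w i h : K) *: X`_i.

(** The operators [ad h], [h] in [t], commute because [t] is abelian.  The
    eigenvalue of [h] on a common eigenvector is linear in [h] because it is
    a coordinate of a bracket. *)
Lemma exists_weight_basis : cartan_subalgebra t ->
  exists X, exists w, @weight_basis (\dim {:g}) X w.
Proof.
move=> [tC _ tD]; pose ad x : 'End(g) := linfun (lie x).
have adE x y : ad x y = lie x y by rewrite lfunE.
have [||X XB Xad] := @common_eigenbasis _ _ [seq ad h | h <- vbasis t].
- move=> _ _ /mapP[h /vbasis_mem ht ->] /mapP[k /vbasis_mem kt ->].
  by apply/lfunP => x;
    rewrite !comp_lfunE !adE lie_derivation (tC h k) // lie0l add0r.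
- move=> _ /mapP[h /vbasis_mem ht ->]; have [Y YB Yh] := tD _ ht.
  by exists Y => // x /Yh[c hx]; exists c; rewrite adE.
have diagX (i : 'I_(\dim {:g})) h :
    h \in t -> lie h X`_i = coord X i (lie h X`_i) *: X`_i.
  move=> /coord_vbasis ->; rewrite lie_suml linear_sum scaler_suml /=.
  apply: eq_bigr => j _; rewrite lieZl linearZ -scalerA; congr (_ *: _) => /=.
  have [|c] := Xad (ad (vbasis t)`_j) _ i.
    by apply: map_f; rewrite mem_nth ?size_tuple.
  rewrite adE => ->.
  by rewrite linearZ /= coord_free ?(basis_free XB) // eqxx mulr1.
have wl (i : 'I_(\dim {:g})) :
    linear (fun h : subvs_of t => coord X i (lie (vsval h) X`_i) : K^o).
  by move=> c h k; rewrite linearP lieDl lieZl linearP.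
pose W i : {linear subvs_of t -> K^o} := HB.pack
  (fun h : subvs_of t => coord X i (lie (vsval h) X`_i) : K^o)
  (GRing.isLinear.Build _ _ _ _ _ (wl i)).
exists X; exists (fun i => linfun (W i)); split=> // i h.
by rewrite lfunE /=; apply/diagX/subvsP.
Qed.

Variables (n : nat) (X : n.-tuple g) (w : 'I_n -> dual).
Hypothesis Xw : weight_basis X w.
Implicit Types (a b : dual) (x y z v : g) (i j k : 'I_n).

Let XB : basis_of fullv X := Xw.1.
Let Xfree := basis_free XB.

Lemma coord_decomposition v : v = \sum_i coord X i v *: X`_i.
Proof. exact: (coord_basis XB (memvf v)). Qed.

Lemma eq_coord u v : (forall i, coord X i u = coord X i v) -> u = v.
Proof.
by move=> uv; rewrite [u]coord_decomposition [v]coord_decomposition;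
  apply: eq_bigr => i _; rewrite uv.
Qed.

Lemma coord_lie_cartan (h : subvs_of t) v i :
  coord X i (lie (vsval h) v) = (w i h : K) * coord X i v.
Proof.
rewrite {1}[v]coord_decomposition linear_sum.
rewrite -(coord_sum_free (fun j => (w j h : K) * coord X j v) i Xfree).
by congr coord; apply: eq_bigr => j _; rewrite linearZ /= Xw.2 scalerA mulrC.
Qed.

(** Coordinates in a basis of weight vectors decide membership in weight
    spaces, so that no direct sum decomposition has to be handled. *)
Lemma memv_weight_coordP a v :
  reflect (forall i, coord X i v != 0 -> w i = a) (v \in weightv a).
Proof.
apply: (iffP (memv_weightP a v)) => [va i vi | vw h].
  apply/lfunP => h; apply: (mulIf vi); rewrite -coord_lie_cartan va.
  by rewrite linearZ.
apply: eq_coord => i; rewrite coord_lie_cartan linearZ /=.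
by have [->|/vw ->] := eqVneq (coord X i v) 0; rewrite ?mulr0.
Qed.

Lemma memv_weight_basis i : X`_i \in weightv (w i).
Proof.
by apply/memv_weight_coordP => j; rewrite (coord_free _ _ Xfree);
  case: (i =P j) => [-> | _]; rewrite ?eqxx.
Qed.

Lemma memv_lie_weight a b x y :
  x \in weightv a -> y \in weightv b -> lie x y \in weightv (a + b).
Proof.
move=> /memv_weightP xa /memv_weightP yb; apply/memv_weightP => h.
by rewrite lie_derivation xa yb lieZl linearZ /= add_lfunE scalerDl.
Qed.

Lemma weightv0 : cartan_subalgebra t -> weightv (0 : dual) = t.
Proof.
move=> [tC tcent _]; apply/vspaceP => x; apply/memv_weightP/idP => [x0 | xt h].
  by apply: tcent => h ht; have := x0 (vsproj t h);
    rewrite vsprojK // lfunE /= scale0r.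
by rewrite lfunE /= scale0r tC ?subvsP.
Qed.

Lemma root_weightP a :
  reflect (a <> 0 /\ exists i, w i = a) (a \in Defs.roots t).
Proof.
apply: (iffP andP) => [[/eqP a0 ga] | [/eqP a0 [i wi]]]; split=> //.
  have [/existsP[i /eqP wi] | /existsPn wa] := boolP [exists i, w i == a].
    by exists i.
  case/eqP: ga; apply/eqP; rewrite -subv0;
    apply/subvP => v /memv_weight_coordP vw.
  rewrite memv0; apply/eqP/eq_coord => i; rewrite linear0.
  by apply/eqP/contraT => /vw wi; have := wa i; rewrite wi eqxx.
apply/eqP => ga0; have := memv_weight_basis i; rewrite wi ga0 memv0 => /eqP Xi0.
have := coord_free i i Xfree; rewrite Xi0 linear0 eqxx => /eqP.
by rewrite eq_sym oner_eq0.
Qed.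

Lemma coord_lie_neq0 x y k : coord X k (lie x y) != 0 ->
  exists i, exists j, [/\ coord X i x != 0, coord X j y != 0 & w k = w i + w j].
Proof.
move=> xy; apply/not_existsP => N; case/eqP: xy.
rewrite [x]coord_decomposition lie_suml linear_sum big1 // => i _.
rewrite lieZl linearZ /=; have [->|xi] := eqVneq (coord X i x) 0;
  first exact: mul0r.
rewrite [y]coord_decomposition !linear_sum big1 ?mulr0 // => j _.
rewrite !linearZ /=; have [->|yj] := eqVneq (coord X j y) 0; first exact: mul0r.
suff -> : coord X k (lie X`_i X`_j) = 0 by rewrite mulr0.
have Xij := memv_lie_weight (memv_weight_basis i) (memv_weight_basis j).
apply/eqP/contraT => /(memv_weight_coordP _ _ Xij) wk.
by case: (N i); exists j.
Qed.

Definition weight_comp a v : g := \sum_(i | w i == a) coord X i v *: X`_i.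

Lemma coord_weight_comp a v i :
  coord X i (weight_comp a v) = if w i == a then coord X i v else 0.
Proof.
rewrite /weight_comp big_mkcond /=.
rewrite -(coord_sum_free
  (fun i => if w i == a then coord X i v else 0) i Xfree).
by congr coord; apply: eq_bigr => j _; case: ifP; rewrite ?scale0r.
Qed.

Lemma weight_comp_linear a : linear (weight_comp a).
Proof.
move=> c u v; rewrite scaler_sumr -big_split /=; apply: eq_bigr => i _.
by rewrite linearP scalerDl scalerA.
Qed.

HB.instance Definition _ a := GRing.isLinear.Build K g g _ (weight_comp a)
  (weight_comp_linear a).

Lemma memv_weight_comp a v : weight_comp a v \in weightv a.
Proof.
by apply/memv_weight_coordP => i; rewrite coord_weight_comp; case: (w i =P a);
  rewrite ?eqxx.
Qed.

Lemma weight_comp_id a v : v \in weightv a -> weight_comp a v = v.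
Proof.
move=> /memv_weight_coordP va; apply: eq_coord => i; rewrite coord_weight_comp.
by case: eqP => // wi; apply/esym/eqP/contraT => /va.
Qed.

Lemma weight_comp_eq0 a b v : v \in weightv b -> b <> a -> weight_comp a v = 0.
Proof.
move=> /memv_weight_coordP va ba; apply: eq_coord => i;
  rewrite coord_weight_comp linear0.
by case: eqP => // wi; apply/eqP/contraT => /va; rewrite wi => /esym.
Qed.

Lemma weight_comp_lie a b x v :
  x \in weightv a -> weight_comp (a + b) (lie x v) = lie x (weight_comp b v).
Proof.
move=> xa; rewrite [v]coord_decomposition (linear_sum (weight_comp b)).
rewrite !linear_sum; apply: eq_bigr => i _.
rewrite !linearZ /=; congr (_ *: _).
have xXi := memv_lie_weight xa (memv_weight_basis i).
have [wi | wi] := eqVneq (w i) b.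
  by rewrite -wi !weight_comp_id ?memv_weight_basis.
rewrite (weight_comp_eq0 (memv_weight_basis i) (elimN eqP wi)) linear0.
by rewrite (weight_comp_eq0 xXi) // => /addrI /eqP; apply/negP.
Qed.

Lemma memv_sum_weightP (s : seq dual) v :
  reflect (forall i, coord X i v != 0 -> w i \in s)
    (v \in (\sum_(a <- s) weightv a)%VS).
Proof.
apply: (iffP idP) => [|vs].
  elim: s v => [|a s IHs] v; rewrite ?big_nil ?big_cons.
    by rewrite memv0 => /eqP-> i; rewrite linear0 eqxx.
  move=> /memv_addP[u /memv_weight_coordP ua [u' /IHs u's ->]] i.
  rewrite inE linearD /=; have [->|/ua -> _] := eqVneq (coord X i u) 0;
    last by rewrite eqxx.
  by rewrite add0r => /u's ->; rewrite orbT.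
rewrite [v]coord_decomposition; apply: memv_suml => i _.
have [->|/vs wi] := eqVneq (coord X i v) 0; first by rewrite scale0r mem0v.
rewrite memvZ // (big_rem (w i)) //=.
exact: (subvP (addvSl _ _)) (memv_weight_basis i).
Qed.

Lemma memv_levi_subalgebraP (t_cartan : cartan_subalgebra t)
    (P : {fset dual}) v :
  reflect (forall i, coord X i v != 0 -> w i = 0 \/ w i \in P)
    (v \in levi_subalgebra P).
Proof.
have -> : levi_subalgebra P =
    (\sum_(a <- (0%R : dual) :: (P : seq dual)) weightv a)%VS.
  by rewrite big_cons (weightv0 t_cartan).
apply: (iffP (memv_sum_weightP _ _)) => vP i /vP; rewrite inE.
  by case/orP => [/eqP|]; [left | right].
by case=> ->; rewrite ?eqxx ?orbT.
Qed.

End WeightBasis.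

(** * Coroot lines in a reductive Lie algebra *)

Section Semisimple.
Variables (K : numFieldType) (g : lieType K) (t : {vspace g}).
Local Notation dual := 'Hom(subvs_of t, K^o).
Hypotheses (g_red : reductive g) (t_cartan : cartan_subalgebra t).
Variables (n : nat) (X : n.-tuple g) (w : 'I_n -> dual).
Hypothesis Xw : weight_basis X w.
Implicit Types (a b : dual) (x y z v : g) (i j k : 'I_n) (h : subvs_of t).

(** Rows are images of basis vectors, so matrices multiply in the order
    opposite to that of the operators. *)
Definition ad_mx x : 'M[K]_n := \matrix_(i, j) coord X j (lie x X`_i).

Lemma ad_mx_mul x y :
  ad_mx y *m ad_mx x = \matrix_(i, j) coord X j (lie x (lie y X`_i)).
Proof.
apply/matrixP => i j;
  rewrite !mxE [lie y _](coord_decomposition Xw) !linear_sum.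
by apply: eq_bigr => k _; rewrite !mxE !linearZ.
Qed.

Lemma ad_mx_lie x y : ad_mx (lie x y) = ad_mx y *m ad_mx x - ad_mx x *m ad_mx y.
Proof.
rewrite !ad_mx_mul; apply/matrixP => i j; rewrite !mxE -linearB /=.
by rewrite lie_adjoint_commutator.
Qed.

Lemma ad_mx_linear : linear ad_mx.
Proof.
by move=> c x y; apply/matrixP => i j; rewrite !mxE lieDl lieZl linearP.
Qed.

HB.instance Definition _ :=
  GRing.isLinear.Build K g 'M[K]_n _ ad_mx ad_mx_linear.

Lemma ad_mx_cartan h : ad_mx (vsval h) = diag_mx (\row_i (w i h : K)).
Proof.
apply/matrixP => i j;
  rewrite !mxE Xw.2 linearZ /= (coord_free _ _ (basis_free Xw.1)).
by rewrite mulr_natr.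
Qed.

Lemma ad_mx_weight a x i j :
  x \in weightv a -> ad_mx x i j != 0 -> w j = a + w i.
Proof.
by move=> xa; rewrite mxE; apply/(memv_weight_coordP Xw)/memv_lie_weight => //;
  apply: memv_weight_basis.
Qed.

(** [S] is a union of [a]-strings of weights, so [ad x] and [ad y] preserve the
    span of the basis vectors with weight in [S], and a commutator has trace
    zero there. *)
Lemma string_trace a x y (S : pred dual) : (forall b, S (a + b) = S b) ->
    x \in weightv a -> y \in weightv (- a) ->
  \sum_(i | S (w i)) ad_mx (lie x y) i i = 0.
Proof.
move=> Sa xa ya; have inS u v : u \in weightv a -> v \in weightv (- a) ->
   \sum_(i | S (w i)) (ad_mx u *m ad_mx v) i i
   = \sum_(i | S (w i)) \sum_(j | S (w j)) ad_mx u i j * ad_mx v j i.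
  move=> ua va; apply: eq_bigr => i Si; rewrite mxE [RHS]big_mkcond;
    apply: eq_bigr => j _.
  case: ifPn => // Sj;
    have [->|/(ad_mx_weight ua) wj] := eqVneq (ad_mx u i j) 0;
    first exact: mul0r.
  by rewrite wj Sa Si in Sj.
have inS' u v : u \in weightv a -> v \in weightv (- a) ->
   \sum_(i | S (w i)) (ad_mx v *m ad_mx u) i i
   = \sum_(i | S (w i)) \sum_(j | S (w j)) ad_mx v i j * ad_mx u j i.
  move=> ua va; apply: eq_bigr => i Si; rewrite mxE [RHS]big_mkcond;
    apply: eq_bigr => j _.
  case: ifPn => // Sj;
    have [->|/(ad_mx_weight ua) wj] := eqVneq (ad_mx u j i) 0;
    first exact: mulr0.
  by rewrite wj Sa in Si; rewrite Si in Sj.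
have trE i : ad_mx (lie x y) i i
    = (ad_mx y *m ad_mx x) i i - (ad_mx x *m ad_mx y) i i.
  by rewrite ad_mx_lie [LHS]mxE [X in _ + X]mxE.
rewrite (eq_bigr _ (fun i _ => trE i)) big_split /= sumrN (inS x y) //.
rewrite (inS' x y) // exchange_big /= -sumrB big1 // => i _.
by rewrite -sumrB big1 // => j _; rewrite mulrC subrr.
Qed.

Local Notation coroot_line a := (lie_prodv (weightv a) (weightv (- a))).

Lemma memv_coroot_line_cartan a v : v \in coroot_line a -> v \in t.
Proof.
move: v; apply: lie_prodv_ind => [|c u u' ut u't|x y xa ya]; first exact: mem0v.
  by rewrite memvD ?memvZ.
by rewrite -(weightv0 t_cartan) -(subrr a) memv_lie_weight.
Qed.

(** On the string of [w i] under [a], of total dimension [N], the vanishing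
    trace of [h] reads [N * w i h + (sum of the m j) * a h = 0], where the
    [j]-th weight of the string is [w i + m j * a]. *)
Lemma weight_coroot_line a i :
  exists2 q : K, q \is Num.real &
    forall h, vsval h \in coroot_line a -> w i h = q * (a h : K) :> K.
Proof.
pose S b := `[< exists m : int, b = w i + a *~ m >].
have Sa b : S (a + b) = S b.
  apply/asboolP/asboolP => -[m bm].
    by exists (m - 1); rewrite mulrzBr addrA -bm addrAC subrr add0r.
  by exists (m + 1); rewrite bm mulrzDr addrCA [a + _]addrC.
have /choice[m mE] j : exists m : int, S (w j) -> w j = w i + a *~ m.
  have [/asboolP[m ->] | NS] := boolP (S (w j)); first by exists m.
  by exists 0 => Sj; case/negP: NS.
pose N := #|[pred j | S (w j)]|.
have N0 : N%:R != 0 :> K.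
  rewrite pnatr_eq0 -lt0n; apply/card_gt0P; exists i.
  by rewrite inE; exists 0; rewrite mulr0z addr0.
exists (- (\sum_(j | S (w j)) (m j)%:~R) / N%:R).
  by rewrite rpred_div ?rpred_nat // rpredN rpred_sum // => j _; apply: realz.
move=> h ht.
have tr0 : \sum_(j | S (w j)) (w j h : K) = 0.
  transitivity (\sum_(j | S (w j)) ad_mx (vsval h) j j).
    by apply: eq_bigr => j _; rewrite ad_mx_cartan !mxE eqxx.
  move: (vsval h) ht; apply: lie_prodv_ind => [|c u u' u0 u'0|x y xa ya].
  - by rewrite big1 // => j _; rewrite linear0 mxE.
  - transitivity (c * (\sum_(j | S (w j)) ad_mx u j j)
        + \sum_(j | S (w j)) ad_mx u' j j); last by rewrite u0 u'0 mulr0 addr0.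
    rewrite mulr_sumr -big_split /=.
    by apply: eq_bigr => j _; rewrite linearP mxE mxE.
  exact: string_trace.
apply: (mulfI N0); rewrite mulrA mulrCA mulfV // mulr1 mulNr.
apply/eqP; rewrite -addr_eq0; apply/eqP; rewrite -{}[RHS]tr0.
have -> : N%:R = \sum_(j | S (w j)) 1 :> K by rewrite /N -sum1_card natr_sum.
rewrite !mulr_suml -big_split /=.
by apply: eq_bigr => j /mE ->; rewrite add_lfunE mul1r -scaler_int scale_lfunE.
Qed.

Lemma cartan_central h :
  (forall i, w i h = 0 :> K) -> forall y, lie (vsval h) y = 0.
Proof.
by move=> h0 y; apply: (eq_coord Xw) => i;
  rewrite (coord_lie_cartan Xw) h0 mul0r linear0.
Qed.

(** With [w i h = q i * a h] and [q i] real, the sum of squares is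
    [(a h)^2] times a sum of nonnegative terms, one of which is [1] when [a]
    is a weight.  It is the reality of the ratios that excludes cancellation:
    the squares themselves may be arbitrary complex numbers. *)
Lemma coroot_line_isotropic a h : vsval h \in coroot_line a ->
  \sum_i (w i h : K) ^+ 2 = 0 -> h = 0.
Proof.
move=> ha sum0; apply/val_inj => /=.
apply: (reductive_central_bracket g_red ha); apply: cartan_central.
have /choice[q qE] i :
    exists q : K, q \is Num.real /\ w i h = q * (a h : K) :> K.
  by have [q qR qE] := weight_coroot_line a i; exists q; rewrite qE.
have [ah0 i | ah0] := eqVneq (a h : K) 0; first by rewrite (qE i).2 ah0 mulr0.
have [[i wi] | Na] := pselect (exists i, w i = a).
  have qi : q i = 1 by apply: (mulIf ah0); rewrite mul1r -(qE i).2 wi.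
  have : 0 < \sum_j q j ^+ 2.
    rewrite (bigD1 i) //= qi expr1n ltr_wpDr ?ltr01 //.
    by rewrite sumr_ge0 // => j _; rewrite real_exprn_even_ge0 ?(qE j).1.
  rewrite lt_neqAle eq_sym => /andP[/negP[]];
    apply/eqP/(mulIf (expf_neq0 2 ah0)).
  rewrite mul0r -[RHS]sum0 mulr_suml; apply: eq_bigr => j _.
  by rewrite (qE j).2 exprMn.
have wa0 x : x \in weightv a -> x = 0.
  move=> /(memv_weight_coordP Xw) xa; apply: (eq_coord Xw) => i;
    rewrite linear0.
  by apply/eqP/contraT => /xa wi; case: Na; exists i.
suff h0 : vsval h = 0.
  by move=> i; rewrite (_ : h = 0) ?linear0 //; apply/val_inj.
move: (vsval h) ha; apply: lie_prodv_ind => [|c u v -> ->|x y /wa0 -> _] //.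
  by rewrite scaler0 addr0.
exact: lie0l.
Qed.

Lemma coroot_line_inj a h : vsval h \in coroot_line a -> a h = 0 :> K -> h = 0.
Proof.
move=> ha ah0; apply: (coroot_line_isotropic ha); apply: big1 => i _.
by have [q _ ->] := weight_coroot_line a i; rewrite // ah0 mulr0 expr0n.
Qed.

(** The Killing form. *)
Definition trace_form x y : K := \tr (ad_mx x *m ad_mx y).

Lemma trace_form_lie x y z : trace_form (lie x y) z = trace_form x (lie y z).
Proof.
rewrite /trace_form !ad_mx_lie mulmxBl mulmxBr !linearB /= -!mulmxA.
by congr (_ - _); rewrite mxtrace_mulC mulmxA.
Qed.

Lemma trace_form_weight a b x y : x \in weightv a -> y \in weightv b ->
  a + b <> 0 -> trace_form x y = 0.
Proof.
move=> xa yb ab; apply: big1 => i _; rewrite mxE; apply: big1 => j _.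
have [->|/(ad_mx_weight xa) wj] := eqVneq (ad_mx x i j) 0; first exact: mul0r.
have [->|/(ad_mx_weight yb) wi] := eqVneq (ad_mx y j i) 0; first exact: mulr0.
case: ab; apply: (addIr (w i)); rewrite add0r {2}wi wj addrA.
by rewrite [b + a]addrC.
Qed.

Lemma trace_form_cartan h :
  trace_form (vsval h) (vsval h) = \sum_i (w i h : K) ^+ 2.
Proof.
rewrite /trace_form ad_mx_cartan mulmx_diag; apply: eq_bigr => i _.
by rewrite !mxE eqxx.
Qed.

Lemma trace_formC x y : trace_form x y = trace_form y x.
Proof. exact: mxtrace_mulC. Qed.

Lemma trace_form_linear x : linear (trace_form x : g -> K^o).
Proof.
by move=> c y y'; rewrite /trace_form linearP mulmxDr -scalemxAr linearP.
Qed.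

HB.instance Definition _ x := GRing.isLinear.Build K g K^o _ (trace_form x)
  (trace_form_linear x).

Lemma trace_form_comp a b x y : a + b = 0 -> x \in weightv a ->
  trace_form x (weight_comp X w b y) = trace_form x y.
Proof.
move=> ab xa; rewrite [y in RHS](coord_decomposition Xw) [RHS]linear_sum /=.
rewrite [y in LHS](coord_decomposition Xw) (linear_sum (weight_comp X w b))
  [LHS]linear_sum /=.
apply: eq_bigr => i _; rewrite !linearZ /=; congr (_ * _).
have Xi := memv_weight_basis Xw i.
have [<- | wi] := eqVneq (w i) b; first by rewrite weight_comp_id.
rewrite (weight_comp_eq0 Xw Xi) ?linear0; last exact/eqP.
rewrite (trace_form_weight xa Xi) // -ab => /addrI/eqP; exact/negP.
Qed.

(** Let [T b] be the trace of [ad x ad y] on the weight space of [b].  Cyclicity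
    of the trace and commutation give [T (a + b) = T b]; as there are finitely
    many weights and the [b + m a] are distinct, [T] vanishes. *)
Lemma trace_form_commuting a x y : a <> 0 ->
  x \in weightv a -> y \in weightv (- a) -> lie x y = 0 -> trace_form x y = 0.
Proof.
move=> a0 xa ya xy0; pose T b := \sum_(i | w i == b) (ad_mx x *m ad_mx y) i i.
have xyC : ad_mx x *m ad_mx y = ad_mx y *m ad_mx x.
  by apply/eqP; rewrite eq_sym -subr_eq0 -ad_mx_lie xy0 linear0.
have Ta b : T (a + b) = T b.
  rewrite {1}/T xyC; transitivity (\sum_(i | w i == a + b) \sum_(j | w j == b)
      ad_mx y i j * ad_mx x j i).
    apply: eq_bigr => i /eqP wi; rewrite mxE [RHS]big_mkcond;
      apply: eq_bigr => j _.
    case: eqP => // wj; have [->|/(ad_mx_weight xa)] := eqVneq (ad_mx x j i) 0.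
      exact: mulr0.
    by rewrite wi => /addrI /esym.
  rewrite exchange_big; apply: eq_bigr => j /eqP wj; rewrite mxE big_mkcond.
  apply: eq_bigr => i _; case: eqP => [_|wi]; first exact: mulrC.
  have [->|/(ad_mx_weight xa)] := eqVneq (ad_mx x j i) 0;
    first by rewrite mul0r.
  by rewrite wj.
have T0 b : T b = 0.
  have [m Tm] : exists m : nat, T (a *+ m + b) = 0.
    apply: contrapT => N; have wm m : exists i, w i = a *+ m + b.
      apply: contrapT => Nm; case: N; exists m; apply: big1 => i /eqP wi.
      by case: Nm; exists i.
    have [f fE] := choice wm.
    have f_inj : injective f.
      move=> p q fpq; have := fE p; rewrite fpq fE => /addIr/eqP.
      rewrite -!scaler_nat -subr_eq0 -scalerBl scaler_eq0 subr_eq0 eqr_nat.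
      by move=> /orP[/eqP-> | /eqP].
    (* an injection of [n + 1] elements into the [n] indices of the basis *)
    have := @leq_card _ _ (f \o @nat_of_ord n.+1) (inj_comp f_inj val_inj).
    by rewrite !card_ord ltnn.
  rewrite -Tm; elim: m {Tm} => [|m IHm]; first by rewrite mulr0n add0r.
  by rewrite mulrS -addrA Ta.
rewrite /trace_form /mxtrace.
rewrite (partition_big (fun i => SeqSub (codom_f w i)) predT) //=.
rewrite big1 // => s _.
by rewrite -[RHS](T0 (ssval s)); apply: eq_bigl.
Qed.

(** The ideal [D] consists of the elements in the kernel of the trace form that
    have no component in [t].  It is stable under brackets with weight vectors
    because the [t]-component of such a bracket lies on a coroot line and is
    isotropic.  It contains [x];
    writing [h] in [t] with [a h != 0] as [d + j] along a complementary ideal,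
    [a h x = [d, x]], and the right-hand side has no component of weight [a]. *)
Lemma coroot_partner a x : a <> 0 -> x \in weightv a ->
  (forall y, y \in weightv (- a) -> lie x y = 0) -> x = 0.
Proof.
move=> a0 xa xy0.
pose inD d := (forall y, trace_form d y = 0) /\ weight_comp X w 0 d = 0.
have [||D DP] := @vspace_of_closed _ g inD.
- by split=> [y|]; rewrite ?linear0 // trace_formC linear0.
- move=> c u v [u0 cu0] [v0 cv0]; split=> [y|].
    by rewrite trace_formC linearP /= ![trace_form y _]trace_formC u0 v0
      scaler0 addr0.
  by rewrite linearP /= cu0 cv0 scaler0 addr0.
have D_ideal : lie_ideal D.
  move=> y d /DP[d0 cd0]; apply/DP.
  have yd0 z u : trace_form (lie z d) u = 0.
    by rewrite trace_formC lieC linearN /= trace_formC trace_form_lie d0 oppr0.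
  split=> //;
    rewrite [y](coord_decomposition Xw) lie_suml linear_sum big1 // => i _.
  rewrite lieZl linearZ /=; set c := weight_comp X w 0 _.
  suff -> : c = 0 by rewrite scaler0.
  have cE : c = lie X`_i (weight_comp X w (- w i) d).
    by rewrite -(weight_comp_lie Xw _ _ (memv_weight_basis Xw i)) subrr.
  have cline : c \in lie_prodv (weightv (w i)) (weightv (- w i)).
    by rewrite cE mem_lie_prodv ?memv_weight_basis ?memv_weight_comp.
  have ct := memv_coroot_line_cartan cline.
  rewrite -(vsprojK ct) in cline *.
  rewrite (coroot_line_isotropic cline) // -trace_form_cartan vsprojK //.
  by rewrite (trace_form_comp _ (addr0 0)) ?memv_weight_comp // trace_formC yd0.
have xD : x \in D.
  apply/DP; split=> [y|]; last exact: (weight_comp_eq0 Xw xa).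
  rewrite -(trace_form_comp _ (subrr a) xa).
  by apply: (trace_form_commuting a0); rewrite ?xy0 ?memv_weight_comp.
have [J [J_ideal DJ DJ0]] := g_red D_ideal.
have [h ah0] : exists h, a h != 0 :> K.
  apply: contrapT => N; apply: a0; apply/lfunP => h; rewrite lfunE /=.
  by apply/eqP/contraT => ah; case: N; exists h.
have /memv_addP[d /DP[_ d0] [j jJ hE]] : vsval h \in (D + J)%VS.
  by rewrite DJ memvf.
have jx : lie j x = 0.
  apply/eqP; rewrite -memv0 -DJ0 memv_cap D_ideal //.
  by rewrite lieC memvN J_ideal.
have /memv_weightP/(_ h) := xa; rewrite hE lieDl jx addr0 => dx.
have : weight_comp X w a (lie d x) = 0.
  rewrite lieC linearN /= -[b in weight_comp _ _ b _]addr0.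
  by rewrite (weight_comp_lie Xw _ _ xa) d0 linear0 oppr0.
rewrite dx linearZ /= (weight_comp_id Xw xa) => /eqP.
by rewrite scaler_eq0 (negPf ah0) => /eqP.
Qed.

Lemma root_neq0 a : a \in Defs.roots t -> a <> 0.
Proof. by case/(root_weightP Xw). Qed.

Lemma coroot_bracket a : a \in Defs.roots t ->
  vsval (coroot a) \in coroot_line a /\ a (coroot a) = 2 :> K.
Proof.
move=> a_root; have a0 := root_neq0 a_root.
suff [h hP] : exists h, vsval h \in coroot_line a /\ a h = 2 :> K.
  by rewrite /coroot; case: xgetP => [_ -> | /(_ h)].
have [x xa x0] : exists2 x, x \in weightv a & x <> 0.
  exists (vpick (weightv a)); first exact: memv_pick.
  by apply/eqP; rewrite vpick0; case/andP: a_root.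
have [y ya xy] : exists2 y, y \in weightv (- a) & lie x y <> 0.
  apply: contrapT => N; apply: x0; apply: (coroot_partner a0 xa) => y ya.
  by apply: contrapT => xy; case: N; exists y.
have xyl := mem_lie_prodv xa ya; have xyt := memv_coroot_line_cartan xyl.
pose h := vsproj t (lie x y); have hE : vsval h = lie x y by rewrite vsprojK.
have ah : a h != 0 :> K.
  apply/eqP => ah; apply: xy; rewrite -hE; suff -> : h = 0 by rewrite linear0.
  by apply: (@coroot_line_inj a) => //; rewrite hE.
exists ((2 / (a h : K)) *: h); rewrite linearZ /= hE memvZ // linearZ /=;
  split=> //.
exact: divfK.
Qed.

Lemma lie_root_coroot a x y : a \in Defs.roots t ->
    x \in weightv a -> y \in weightv (- a) ->
  exists c : K, lie x y = c *: vsval (coroot a).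
Proof.
move=> a_root xa ya; have [cl a2] := coroot_bracket a_root.
have xyl := mem_lie_prodv xa ya; have xyt := memv_coroot_line_cartan xyl.
pose h := vsproj t (lie x y); have hE : vsval h = lie x y by rewrite vsprojK.
pose c := (a h : K) / 2; suff hc : h - c *: coroot a = 0.
  exists c; move/(congr1 vsval): hc.
  by rewrite linearB linearZ linear0 /= hE scalerN => /subr0_eq.
apply: (@coroot_line_inj a);
  first by rewrite linearB linearZ /= hE scalerN memvB ?memvZ.
by rewrite linearB linearZ /= a2 /c [_ *: _]divfK ?pnatr_eq0 // subrr.
Qed.

(** Both sides lie on the same coroot line, where [a] is injective. *)
Lemma coroot_opp a : a \in Defs.roots t -> - a \in Defs.roots t ->
  coroot (- a) = - coroot a.
Proof.
move=> ra rNa; have [la a2] := coroot_bracket ra.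
have [lNa Na2] := coroot_bracket rNa.
have lNa' : vsval (coroot (- a)) \in lie_prodv (weightv a) (weightv (- a)).
  move: (vsval _) lNa; apply: lie_prodv_ind => [|c u u' ul u'l|x y xa ya].
  - exact: mem0v.
  - by rewrite memvD ?memvZ.
  by rewrite opprK in ya; rewrite lieC memvN mem_lie_prodv.
apply/eqP; rewrite -addr_eq0; apply/eqP.
apply: (@coroot_line_inj a); first by rewrite linearD /= memvD.
have Na2' : a (coroot (- a)) = - 2 :> K.
  by apply: oppr_inj; rewrite opprK -Na2 opp_lfunE.
by rewrite linearD /= a2 Na2' addNr.
Qed.

End Semisimple.

(** * Central pairings on truncated currents *)

Section Currents.
Variables (K : numFieldType) (g : lieType K) (t : {vspace g}).
Local Notation dual := 'Hom(subvs_of t, K^o).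
Hypotheses (g_red : reductive g) (t_cartan : cartan_subalgebra t).
Variables (n : nat) (X : n.-tuple g) (w : 'I_n -> dual).
Hypothesis Xw : weight_basis X w.
Implicit Types (a b : dual) (x y z v : g) (h : subvs_of t).

Variable r : nat.
Implicit Types (Y Z : currents r g).

Lemma currents_decomposition Z : Z = \sum_k monomial k (Z k).
Proof.
apply/ffunP => j; rewrite sum_ffunE (bigD1 j) //= ffunE eqxx big1 ?addr0 //.
by move=> i /negPf ij; rewrite ffunE eq_sym ij.
Qed.

Lemma coord_lie_currents_neq0 Y Z (k : 'I_r) l : coord X l (lie Y Z k) != 0 ->
  exists (i j : 'I_r) (l1 l2 : 'I_n), [/\ (i + j)%N = k, coord X l1 (Y i) != 0,
    coord X l2 (Z j) != 0 & w l = w l1 + w l2].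
Proof.
move=> YZ; apply: contrapT => N; case/eqP: YZ;
  rewrite ffunE linear_sum big1 // => i _.
rewrite linear_sum big1 // => j /eqP ijk;
  apply/eqP/contraT => /(coord_lie_neq0 Xw).
by case=> l1 [l2 [? ? ?]]; case: N; exists i, j, l1, l2.
Qed.

(** The bilinear form obtained by applying [lam_k] to the component in [t] of
    the coefficient of [eps^k]; unlike the pairing defined by the projection to
    the Levi currents, it is visibly antisymmetric. *)
Definition central_pairing (lam : 'I_r -> dual) Y Z : K :=
  \sum_k (lam k (vsproj t (weight_comp X w 0 (lie Y Z k))) : K).

Lemma central_pairingC lam Y Z :
  central_pairing lam Y Z = - central_pairing lam Z Y.
Proof.
rewrite /central_pairing -sumrN; apply: eq_bigr => k _.
by rewrite lieC ffunE !linearN.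
Qed.

Lemma central_pairing_monomial lam Y (j : 'I_r) a y : y \in weightv (- a) ->
  central_pairing lam Y (monomial j y) =
  \sum_(k < r) \sum_(i < r | (i + j == k)%N)
     (lam k (vsproj t (lie (weight_comp X w a (Y i)) y)) : K).
Proof.
move=> ya; apply: eq_bigr => k _;
  rewrite ffunE (linear_sum (weight_comp X w 0)).
rewrite (linear_sum (vsproj t)) (linear_sum (lam k)) /= [RHS]big_mkcond.
apply: eq_bigr => i _.
rewrite (eq_bigr (fun j' => if j' == j then lie (Y i) y else 0)); last first.
  by move=> j' _; rewrite ffunE; case: eqP => // _; rewrite linear0.
rewrite -big_mkcondr /=; case: ifPn => [/eqP ijk | ijk]; last first.
  rewrite big_pred0 ?linear0 // => j'; rewrite andbC.
  by case: (j' =P j) => //= ->; apply/negbTE.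
rewrite (big_pred1 j) => [|j']; last first.
  by rewrite andbC /=; case: (j' =P j) => //= ->; rewrite ijk eqxx.
rewrite [lie (Y i) y]lieC linearN /= -[Z in weight_comp _ _ Z _](addNr a).
by rewrite (weight_comp_lie Xw _ _ ya) [lie (weight_comp _ _ _ _) y]lieC.
Qed.

(** [E i b] allows the weight [b] at level [i].  Stating the Hankel argument for
    an arbitrary [E] covers both nilradicals, which differ by the sign of the
    weights.  If [Y] has a nonzero component of weight [b], the first one, at
    level [i], is tested against level [e - i]: lower levels of [Y] contribute
    nothing, higher ones are paired by some [lam_k] with [k > e]. *)
Lemma central_pairing_nondegenerate (lam : 'I_r -> dual)
    (E : nat -> dual -> Prop) Y :
    (forall (i : 'I_r) b, E i b -> b \in Defs.roots t /\
       exists e : 'I_r, [/\ (i <= e)%N, forall j, (j <= e)%N -> E j b,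
         lam e (coroot b) != 0 :> K &
         forall j : 'I_r, (e < j)%N -> lam j (coroot b) = 0]) ->
    (forall (k : 'I_r) i, coord X i (Y k) != 0 -> E k (w i)) ->
    (forall (j : 'I_r) b y, E j b -> y \in weightv (- b) ->
       central_pairing lam Y (monomial j y) = 0) ->
  Y = 0.
Proof.
move=> E_last Y_E Y0; apply: contrapT => Yn0.
have [[k0 i0] Yki] : exists p : 'I_r * 'I_n, coord X p.2 (Y p.1) != 0.
  apply: contrapT => N; apply: Yn0; apply/ffunP => k; apply: (eq_coord Xw) => i.
  rewrite ffunE linear0; apply/eqP/contraT => Yki; case: N; by exists (k, i).
pose b := w i0; pose Yb k := weight_comp X w b (Y k).
have Yb0 : Yb k0 != 0.
  by apply: contraNneq Yki => /(congr1 (coord X i0));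
    rewrite /= linear0 (coord_weight_comp Xw) eqxx => ->.
case: (@arg_minnP _ k0 (fun k => Yb k != 0) val Yb0) => i Yi i_min.
have Eib : E i b.
  have [l] : exists l, coord X l (Yb i) != 0.
    apply: contrapT => N; case/eqP: Yi; apply: (eq_coord Xw) => l;
      rewrite linear0.
    by apply/eqP/contraT => Yl; case: N; exists l.
  by rewrite (coord_weight_comp Xw); case: (w l =P b) => [<- /Y_E // | _];
    rewrite eqxx.
have [b_root [e [ie Eb lame lam0]]] := E_last _ _ Eib.
have b0 := root_neq0 Xw b_root.
have Ybw k : Yb k \in weightv b by apply: memv_weight_comp.
have [y yb Yy] : exists2 y, y \in weightv (- b) & lie (Yb i) y <> 0.
  apply: contrapT => N; case/eqP: Yi.
  apply: (coroot_partner g_red t_cartan Xw b0 (Ybw i)) => y yb.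
  by apply: contrapT => Yy; case: N; exists y.
have jr : (e - i < r)%N by apply: leq_ltn_trans (leq_subr _ _) (ltn_ord e).
have := Y0 (Ordinal jr) b y (Eb _ (leq_subr _ _)) yb.
rewrite (central_pairing_monomial _ _ _ yb).
rewrite (bigD1 e) //= (bigD1 i) /= ?subnKC //.
rewrite [X in _ + X + _]big1 => [|i' /andP[/eqP i'e /negP[]]]; last first.
  by apply/eqP/val_inj; apply: (@addIn (e - i)%N); rewrite i'e subnKC.
rewrite [X in _ + X]big1 => [|k ke]; last first.
  apply: big1 => i' /eqP i'k; have [i'i | ii'] := ltnP i' i.
    suff -> : weight_comp X w b (Y i') = 0 by rewrite lie0l !linear0.
    by apply/eqP/contraT => /i_min; rewrite leqNgt i'i.
  have [c ->] := lie_root_coroot g_red t_cartan Xw b_root (Ybw i') yb.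
  have ek : (e < k)%N.
    rewrite ltn_neqAle eq_sym (inj_eq val_inj) ke -i'k /=.
    by rewrite -{1}(subnKC ie) leq_add2r.
  by rewrite !linearZ /= vsvalK lam0 // scaler0.
rewrite !addr0;
  have [c cE] := lie_root_coroot g_red t_cartan Xw b_root (Ybw i) yb.
rewrite -/(Yb i) {1}cE !linearZ /= vsvalK => clam.
suff c0 : c = 0 by apply: Yy; rewrite cE c0 scale0r.
by apply: (mulIf lame); rewrite mul0r.
Qed.

End Currents.

(** * Parabolic filtrations *)

Section Parabolic.
Variables (K : fieldType) (g : lieType K) (t : {vspace g}).
Local Notation dual := 'Hom(subvs_of t, K^o).
Variables (r : nat) (psi : nat -> {fset dual}).
Hypothesis psiF : parabolic_filtration r psi.
Implicit Types a b : dual.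

Lemma mem_levi i a : (a \in levi psi i) = (a \in psi i) && (- a \in psi i).
Proof. by rewrite !inE. Qed.

Lemma levi_opp i a : (- a \in levi psi i) = (a \in levi psi i).
Proof. by rewrite !mem_levi opprK andbC. Qed.

Lemma mem_nilradical i a :
  (a \in psi i `\` levi psi i)%fset = (a \in psi i) && (- a \notin psi i).
Proof.
by rewrite in_fsetD mem_levi; case: (a \in psi i); rewrite ?andbF ?andbT.
Qed.

Lemma filtration_root i a : a \in psi i -> a \in Defs.roots t.
Proof. by have [/(_ i)[+ _ _] _ _] := psiF; apply. Qed.

Lemma filtration_total i a :
  a \in Defs.roots t -> (a \in psi i) || (- a \in psi i).
Proof. by have [/(_ i)[_ _ ->] _ _] := psiF. Qed.

Lemma root_opp a : a \in Defs.roots t -> - a \in Defs.roots t.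
Proof. by have [/(_ 0%N)[_ _ aP] _ _] := psiF; rewrite -!aP opprK orbC. Qed.

Lemma filtration_mono i j a : (i <= j)%N -> a \in psi i -> a \in psi j.
Proof.
have [_ psiS _] := psiF; move=> /subnK <-; elim: (j - i)%N => // m IHm /IHm.
by rewrite addSn; apply: psiS.
Qed.

Lemma levi_mono i j a : (i <= j)%N -> a \in levi psi i -> a \in levi psi j.
Proof.
by move=> ij; rewrite !mem_levi => /andP[? ?]; rewrite !(@filtration_mono i j).
Qed.

Lemma filtration_add i a b : a \in psi i -> b \in psi i ->
  a + b \in Defs.roots t -> a + b \in psi i.
Proof. by have [/(_ i)[_ psiD _] _ _] := psiF; apply: psiD. Qed.

Lemma levi_add i a b : a \in levi psi i -> b \in levi psi i ->
  a + b \in Defs.roots t -> a + b \in levi psi i.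
Proof.
rewrite !mem_levi => /andP[aP NaP] /andP[bP NbP] ab.
by rewrite opprD !filtration_add // -opprD root_opp.
Qed.

(** [e + 1] is the first level at which [- a] appears. *)
Lemma nilradical_interval (i : 'I_r) a : a \in (psi i `\` levi psi i)%fset ->
  exists e : 'I_r, [/\ (i <= e)%N,
    forall j, (j <= e)%N -> a \in (psi j `\` levi psi j)%fset &
    forall j, (e < j)%N -> a \in levi psi j].
Proof.
rewrite mem_nilradical => /andP[ai Nai]; have [_ _ psi_r] := psiF.
have a_root := filtration_root ai; have Na_root := root_opp a_root.
have exm : exists m, - a \in psi m by exists r; rewrite psi_r.
case: (ex_minnP exm) => -[|m] Nam m_min.
  by rewrite (filtration_mono _ Nam) in Nai.
have mr : (m < r)%N by apply: m_min; rewrite psi_r.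
have Naj j : (j <= m)%N -> - a \notin psi j.
  by move=> jm; apply/negP => /m_min; rewrite ltnNge jm.
exists (Ordinal mr); split=> /= [|j jm|j mj].
- by rewrite leqNgt; apply/negP => mi; rewrite (filtration_mono mi Nam) in Nai.
- rewrite mem_nilradical Naj // andbT; have := filtration_total j a_root.
  by rewrite (negPf (Naj _ jm)) orbF.
rewrite mem_levi (filtration_mono mj Nam) andbT.
rewrite (filtration_mono _ (_ : a \in psi 0%N)) //.
by have := filtration_total 0 a_root; rewrite (negPf (Naj _ _)) ?orbF.
Qed.

End Parabolic.

(** * Nonsingular characters *)

Section Nonsingular.
Variables (K : numFieldType) (g : lieType K) (t : {vspace g}).
Local Notation dual := 'Hom(subvs_of t, K^o).
Hypotheses (g_red : reductive g) (t_cartan : cartan_subalgebra t).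
Variables (n : nat) (X : n.-tuple g) (w : 'I_n -> dual).
Hypothesis Xw : weight_basis X w.
Variables (r : nat) (psi : nat -> {fset dual}).
Hypothesis psiF : parabolic_filtration r psi.
Implicit Types (a : dual) (x v : g) (Y Z : currents r g).

Lemma mem_levi_currentsP Z :
  reflect (forall (k : 'I_r) i, coord X i (Z k) != 0 ->
      w i = 0 \/ w i \in levi psi k)
    (Z \in levi_currents r (levi psi)).
Proof.
apply: (iffP (mem_graded_currents _ _)) => ZP k;
  first exact/(memv_levi_subalgebraP Xw t_cartan).
exact/(memv_levi_subalgebraP Xw t_cartan)/ZP.
Qed.

Lemma mem_nil_plusP Z :
  reflect (forall (k : 'I_r) i, coord X i (Z k) != 0 ->
      w i \in (psi k `\` levi psi k)%fset)
    (Z \in nil_plus r psi).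
Proof.
by apply: (iffP (mem_graded_currents _ _)) => ZP k;
  apply/(memv_sum_weightP Xw)/ZP.
Qed.

Lemma mem_nil_minusP Z :
  reflect (forall (k : 'I_r) i, coord X i (Z k) != 0 ->
      - w i \in (psi k `\` levi psi k)%fset)
    (Z \in nil_minus r psi).
Proof.
have mem_opp (k : 'I_r) v :
    reflect (forall i, coord X i v != 0 ->
        - w i \in (psi k `\` levi psi k)%fset)
      (v \in (\sum_(a <- (psi k `\` levi psi k)%fset) weightv (- a))%VS).
  rewrite -(big_map (fun a : dual => - a) xpredT (@weightv _ g t)).
  apply: (iffP (memv_sum_weightP Xw _ _)) => vP i /vP.
    by case/mapP => a aP ->; rewrite opprK.
  by move=> iP; rewrite -[w i]opprK; apply: map_f.
by apply: (iffP (mem_graded_currents _ _)) => ZP k; apply/mem_opp/ZP.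
Qed.

(** The weights of the Levi factor are stable under negation, whereas a weight
    and its negative are never both in the nilradical. *)
Lemma levi_nil_cap :
  (levi_currents r (levi psi) :&: (nil_minus r psi + nil_plus r psi) = 0)%VS.
Proof.
apply/eqP; rewrite -subv0; apply/subvP => Z;
  rewrite memv_cap => /andP[/mem_levi_currentsP Zl].
move=> /memv_addP[U /mem_nil_minusP Um [V /mem_nil_plusP Vp ZE]].
rewrite memv0; apply/eqP/ffunP => k; apply: (eq_coord Xw) => i;
  rewrite ffunE linear0.
apply/eqP/contraT => Zi; have wiN : (w i \in psi k) = (- w i \in psi k).
  by have [->|] := Zl _ _ Zi; rewrite ?oppr0 // mem_levi => /andP[-> ->].
move: Zi; rewrite ZE ffunE linearD /=.
have [->|/Um] := eqVneq (coord X i (U k)) 0; last first.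
  by rewrite mem_nilradical opprK wiN andbN.
by rewrite add0r => /Vp; rewrite mem_nilradical wiN andbN.
Qed.

Lemma levi_projection_levi Z : Z \in levi_currents r (levi psi) ->
  levi_projection r psi Z = Z.
Proof. exact: daddv_pi_id levi_nil_cap. Qed.

Lemma levi_projection_nil Z : Z \in (nil_minus r psi + nil_plus r psi)%VS ->
  levi_projection r psi Z = 0.
Proof.
move=> Zn; apply: (addIr (daddv_pi (nil_minus r psi + nil_plus r psi)
                                   (levi_currents r (levi psi)) Z)).
rewrite daddv_pi_add ?levi_nil_cap //; last exact: (subvP (addvSr _ _)).
by rewrite add0r daddv_pi_id // capvC levi_nil_cap.
Qed.

Lemma lie_levi_currents Y Z : Y \in levi_currents r (levi psi) ->
  Z \in levi_currents r (levi psi) -> lie Y Z \in levi_currents r (levi psi).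
Proof.
move=> /mem_levi_currentsP Yl /mem_levi_currentsP Zl;
  apply/mem_levi_currentsP => k l.
case/(coord_lie_currents_neq0 Xw) => i [j [l1 [l2 [ijk /Yl l1P /Zl l2P wl]]]].
have [/eqP | wl0] := eqVneq (w l) 0; [by left; apply/eqP | right].
have ik : (i <= k)%N by rewrite -ijk leq_addr.
have jk : (j <= k)%N by rewrite -ijk leq_addl.
have wl_root : w l \in Defs.roots t.
  by apply/(root_weightP Xw); split; [apply/eqP | exists l].
case: l1P => [w1|/(levi_mono psiF ik) w1];
  case: l2P => [w2|/(levi_mono psiF jk) w2].
- by rewrite wl w1 w2 addr0 eqxx in wl0.
- by rewrite wl w1 add0r.
- by rewrite wl w2 addr0.
by rewrite wl (levi_add psiF) // -wl.
Qed.

Variable chi : 'Hom(subvs_of (singularity_algebra r psi), K^o).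

Lemma restrict_leviE Z : Z \in levi_currents r (levi psi) ->
  restrict_levi chi (vsproj _ Z) = chi (vsproj _ Z).
Proof.
move=> Zl; have lin : linear (fun U : subvs_of (levi_currents r (levi psi)) =>
    chi (vsproj (singularity_algebra r psi) (vsval U))).
  by move=> c U V; rewrite !linearP.
pose f : {linear _ -> _} := HB.pack
  (fun U : subvs_of (levi_currents r (levi psi)) =>
    chi (vsproj (singularity_algebra r psi) (vsval U)))
  (GRing.isLinear.Build _ _ _ _ _ lin).
by rewrite (lfunE f) /= vsprojK.
Qed.

Variable lam : 'I_r -> dual.
Hypothesis chi_lam : character_of_covectors chi lam.

Lemma chi_nil_plus Z : Z \in nil_plus r psi -> chi (vsproj _ Z) = 0.
Proof.
move=> /mem_nil_plusP Zn;
  rewrite [Z]currents_decomposition !linear_sum big1 // => k _.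
rewrite [Z k](coord_decomposition Xw) !linear_sum big1 // => i _.
rewrite !linearZ /=; have [->|/Zn] := eqVneq (coord X i (Z k)) 0;
  first by rewrite scale0r.
rewrite mem_nilradical => /andP[wi _].
by rewrite (chi_lam.2 k _ _ wi (memv_weight_basis Xw i)) scaler0.
Qed.

(** Both sides are linear in the bracket, so it suffices to compare them on
    [X_i eps^k], according to whether the weight of [X_i] is zero, in the Levi
    factor, or in one of the nilradicals. *)
Lemma levi_pairingE Y Z :
  levi_pairing (restrict_levi chi) Y Z = central_pairing X w lam Y Z.
Proof.
rewrite /levi_pairing /central_pairing.
rewrite restrict_leviE ?memv_pi //; move: (lie Y Z) => {Y}Z.
pose f k x : K := chi (vsproj (singularity_algebra r psi)
  (levi_projection r psi (monomial k x))).
transitivity (\sum_k f k (Z k));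
  first by rewrite {1}[Z]currents_decomposition !linear_sum.
apply: eq_bigr => k _; set x := Z k.
transitivity (\sum_i coord X i x * f k X`_i).
  rewrite {1}[x](coord_decomposition Xw) /f !linear_sum; apply: eq_bigr => i _.
  by rewrite !linearZ.
rewrite [x in RHS](coord_decomposition Xw) (linear_sum (weight_comp X w 0)).
rewrite (linear_sum (vsproj t)) (linear_sum (lam k)); apply: eq_bigr => i _.
rewrite !linearZ /= /f; congr (_ * _); have Xi := memv_weight_basis Xw i.
have monoP (j : 'I_r) l :
    coord X l (monomial k X`_i j) != 0 -> j = k /\ w l = w i.
  rewrite ffunE; case: (j =P k) => [-> /(memv_weight_coordP Xw _ _ Xi) // | _].
  by rewrite linear0 eqxx.
have [wi0 | /eqP wi0] := eqVneq (w i) 0.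
  rewrite levi_projection_levi; last first.
    by apply/mem_levi_currentsP => j l /monoP[_ ->]; left.
  rewrite wi0 in Xi; rewrite (weight_comp_id Xw Xi).
  rewrite -(chi_lam.1 k (vsproj t X`_i)) vsprojK //.
  by rewrite -(weightv0 t_cartan).
rewrite (weight_comp_eq0 Xw Xi wi0) !linear0.
have wi_root : w i \in Defs.roots t.
  by apply/(root_weightP Xw); split=> //; exists i.
have [wil | wil] := boolP (w i \in levi psi k).
  rewrite levi_projection_levi; last first.
    by apply/mem_levi_currentsP => j l /monoP[-> ->]; right.
  by rewrite (chi_lam.2 k (w i)) //; move: wil; rewrite mem_levi => /andP[].
rewrite levi_projection_nil ?linear0 //.
have [wip | wip] := boolP (w i \in psi k).
  apply: (subvP (addvSr _ _)); apply/mem_nil_plusP => j l /monoP[-> ->].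
  by rewrite in_fsetD wil.
apply: (subvP (addvSl _ _)); apply/mem_nil_minusP => j l /monoP[-> ->].
rewrite in_fsetD levi_opp wil; have := filtration_total psiF k wi_root.
by rewrite (negPf wip).
Qed.

(** The remaining conditions of nonsingularity hold because the Levi currents
    form a subalgebra and [chi] itself is the extension by zero. *)
Lemma nonsingularE : lie_character chi ->
  nonsingular (restrict_levi chi) <->
  nondegenerate_on (nil_plus r psi) (nil_minus r psi) (central_pairing X w lam).
Proof.
move=> chi_char.
have pairE : levi_pairing (restrict_levi chi) = central_pairing X w lam.
  by apply/funext => Y; apply/funext => Z; apply: levi_pairingE.
rewrite /nonsingular pairE; split=> [[] // | nd]; split=> //.
  move=> Y Z Yl Zl; rewrite restrict_leviE ?lie_levi_currents //.
  by apply: chi_char; apply: (subvP (addvSl _ _)).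
exists chi => //; split; first by move=> Z Zl; rewrite restrict_leviE.
exact: chi_nil_plus.
Qed.

Lemma monomial_nil_plus (j : 'I_r) a x : a \in (psi j `\` levi psi j)%fset ->
  x \in weightv a -> monomial j x \in nil_plus r psi.
Proof.
move=> aj /(memv_weight_coordP Xw) xa; apply/mem_nil_plusP => k i.
rewrite ffunE; case: (k =P j) => [-> /xa -> // | _].
by rewrite linear0 eqxx.
Qed.

Lemma monomial_nil_minus (j : 'I_r) a x : a \in (psi j `\` levi psi j)%fset ->
  x \in weightv (- a) -> monomial j x \in nil_minus r psi.
Proof.
move=> aj /(memv_weight_coordP Xw) xa; apply/mem_nil_minusP => k i.
rewrite ffunE; case: (k =P j) => [-> /xa -> // | _]; first by rewrite opprK.
by rewrite linear0 eqxx.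
Qed.

Hypothesis lam_central : central_covectors (levi psi) lam.

(** For the negative nilradical the roots are negated, which changes the coroots
    by a sign, and the form is antisymmetric. *)
Lemma nondegenerate_of_stratum :
  (forall (i : 'I_r) a, a \in (levi psi i.+1 `\` levi psi i)%fset ->
     lam i (coroot a) != 0) ->
  nondegenerate_on (nil_plus r psi) (nil_minus r psi) (central_pairing X w lam).
Proof.
move=> lamN.
have last_plus (i : 'I_r) a : a \in (psi i `\` levi psi i)%fset ->
   a \in Defs.roots t /\ exists e : 'I_r, [/\ (i <= e)%N,
     forall j, (j <= e)%N -> a \in (psi j `\` levi psi j)%fset,
     lam e (coroot a) != 0 :> K &
     forall j : 'I_r, (e < j)%N -> lam j (coroot a) = 0].
  move=> ai; split.
    by move: ai; rewrite mem_nilradical => /andP[/(filtration_root psiF)].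
  have [e [ie ae ea]] := nilradical_interval psiF ai.
  exists e; split=> // [|j /ea]; last exact: lam_central.
  apply: lamN; rewrite in_fsetD (ea e.+1) // andbT.
  by have := ae _ (leqnn e); rewrite in_fsetD => /andP[].
split=> [Y /mem_nil_plusP Yn Y0 | Z /mem_nil_minusP Zn Z0].
  apply: (central_pairing_nondegenerate g_red t_cartan Xw last_plus Yn).
  by move=> j a y aj ya; exact/Y0/monomial_nil_minus/ya.
apply: (central_pairing_nondegenerate g_red t_cartan Xw (lam := lam)
  (E := fun k a => - a \in (psi k `\` levi psi k)%fset))
  => [i a /last_plus||j a y aj ya] //.
  move=> [Na_root [e [ie Ee lame lam0]]].
  have a_root : a \in Defs.roots t by rewrite -[a]opprK (root_opp psiF).
  have corootN : coroot a = - coroot (- a).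
    by rewrite (coroot_opp g_red t_cartan Xw a_root Na_root) opprK.
  split=> //; exists e; split=> // [|j /lam0 lamj]; rewrite corootN linearN /=.
    by rewrite oppr_eq0.
  by rewrite lamj oppr0.
have := Z0 _ (monomial_nil_plus aj ya); rewrite central_pairingC => /eqP.
by rewrite oppr_eq0 => /eqP.
Qed.

(** If [lam_i] vanishes on the coroot of [a], then [x eps^i], with [x] in [g_a],
    is in the kernel: it only meets the levels [k >= i], and [lam_k] vanishes on
    that coroot for [k > i]. *)
Lemma stratum_of_nondegenerate :
  nondegenerate_on (nil_plus r psi) (nil_minus r psi) (central_pairing X w lam) ->
  forall (i : 'I_r) a, a \in (levi psi i.+1 `\` levi psi i)%fset ->
     lam i (coroot a) != 0.
Proof.
move=> [nd _] i a.
(* One of the roots [a], [- a] is in [psi i], and their coroots are opposite. *)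
wlog ai : a / a \in psi i.
  move=> wl aD; have := aD; rewrite in_fsetD => /andP[_].
  rewrite mem_levi => /andP[/(filtration_root psiF) a_root _].
  have [/wl/(_ aD)//|] := orP (filtration_total psiF i a_root).
  move=> /wl; rewrite in_fsetD !levi_opp -in_fsetD => /(_ aD).
  rewrite (coroot_opp g_red t_cartan Xw) ?(root_opp psiF) // linearN /=.
  by rewrite oppr_eq0.
rewrite in_fsetD => /andP[Nai ai1]; have a_root := filtration_root psiF ai.
have aD : a \in (psi i `\` levi psi i)%fset by rewrite in_fsetD Nai.
apply/negP => /eqP lam0.
have [x xa x0] : exists2 x, x \in weightv a & x <> 0.
  exists (vpick (weightv a)); first exact: memv_pick.
  by apply/eqP; rewrite vpick0; case/andP: a_root.
case: x0; suff /ffunP/(_ i) : monomial i x = 0 by rewrite !ffunE eqxx.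
apply: nd => [|Y Yn]; first exact: monomial_nil_plus xa.
have xNNa : x \in weightv (- - a) by rewrite opprK.
rewrite central_pairingC (central_pairing_monomial Xw _ _ _ xNNa).
rewrite big1 ?oppr0 // => k _; rewrite big1 // => j /eqP jik.
have ik : (i <= k)%N by rewrite -jik leq_addl.
have [c cE] := lie_root_coroot g_red t_cartan Xw a_root xa
  (memv_weight_comp Xw (- a) (Y j)).
rewrite lieC cE !linearN !linearZ /= vsvalK.
have -> : lam k (coroot a) = 0; last by rewrite ?(oppr0, scaler0).
have [ki | ki] := eqVneq (k : nat) i.
  by rewrite (_ : k = i) //; apply: val_inj.
apply/lam_central/(levi_mono psiF _ ai1).
by rewrite ltn_neqAle eq_sym ki.
Qed.

End Nonsingular.

Theorem proposition14p1p5 (R : realType) (g : lieType R[i]) (t : {vspace g})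
    (g_reductive : reductive g) (t_cartan : cartan_subalgebra t)
    (r : nat) (r_gt0 : (0 < r)%N)
    (psi : nat -> {fset 'Hom(subvs_of t, R[i]^o)})
    (psi_filtration : parabolic_filtration r psi)
    (chi : 'Hom(subvs_of (singularity_algebra r psi), R[i]^o))
    (chi_character : lie_character chi)
    (lam : 'I_r -> 'Hom(subvs_of t, R[i]^o))
    (lam_central : central_covectors (levi psi) lam)
    (chi_lam : character_of_covectors chi lam) :
  (nonsingular (restrict_levi chi) <-> dual_stratum (levi psi) lam) /\
  (nonsingular (restrict_levi chi) <->
   forall (i : 'I_r) a, a \in (levi psi i.+1 `\` levi psi i)%fset ->
     lam i (coroot a) != 0).
Proof.
have [X [w Xw]] := exists_weight_basis t_cartan.
have main : nonsingular (restrict_levi chi) <->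
   forall (i : 'I_r) a, a \in (levi psi i.+1 `\` levi psi i)%fset ->
     lam i (coroot a) != 0.
  rewrite (nonsingularE t_cartan Xw psi_filtration chi_lam chi_character).
  split; first exact: (stratum_of_nondegenerate g_reductive t_cartan Xw
                         psi_filtration lam_central).
  exact: (nondegenerate_of_stratum g_reductive t_cartan Xw psi_filtration
            lam_central).
split=> //; rewrite main; split=> [lamN i | lamS i]; last exact: (lamS i).2.
by split=> [a|a]; [apply: lam_central | apply: lamN].
Qed.
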